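(* There exist two dynamical systems $(X_1,T_1)$ and $(X_2,T_2)$, each having dense periodic measures, such that the product system $(X_1\times X_2,T_1\times T_2)$ does not have dense periodic measures.
   Context: A dynamical system is a pair $(X,T)$ where $X$ is a compact metrizable space and $T:X\to X$ a homeomorphism. $(X,T)$ has dense periodic measures if the finitely supported $T$-invariant Borel probability measures are weak-* dense in the space $\mathcal{M}_T(X)$ of all $T$-invariant Borel probability measures on $X$. *)

(* Defs.v *)
From HB Require Import structures.
From mathcomp Require Import all_boot all_order all_algebra.
From mathcomp Require Import all_classical all_reals all_analysis.
Set Implicit Arguments. Unset Strict Implicit. Unset Printing Implicit Defensive.
Import Order.TTheory GRing.Theory Num.Theory numFieldNormedType.Exports.
Local Open Scope classical_set_scope.
Local Open Scope ring_scope.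

Notation borel X := (g_sigma_algebraType (@open X)).

(* A dynamical system (X,T): X compact metrizable (a Hausdorff metric space,
   whose topology is the metric one), T : X -> X a homeomorphism. *)
Definition homeomorphism (X : ptopologicalType) (T : X -> X) : Prop :=
  continuous T /\ exists S : X -> X,
    [/\ cancel T S, cancel S T & continuous S].

Definition dynamical_system (R : realType) (X : pseudoPMetricType R)
  (T : X -> X) : Prop :=
  [/\ compact [set: X], hausdorff_space X & homeomorphism T].

Definition invariant (R : realType) (X : ptopologicalType) (T : X -> X)
  (mu : probability (borel X) R) : Prop :=
  forall A : set (borel X), measurable A -> mu (T @^-1` A) = mu A.

Definition finitely_supported (R : realType) (X : ptopologicalType)
  (mu : probability (borel X) R) : Prop :=
  exists F : set (borel X), [/\ finite_set F, measurable F & mu F = 1%E].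

(* Dense periodic measures: the finitely supported invariant probability
   measures are weak-* dense in the invariant ones, i.e. every basic
   weak-* neighbourhood of an invariant measure (given by finitely many
   continuous real functions and a radius eps > 0) contains a finitely
   supported invariant measure. *)
Definition dense_periodic_measures (R : realType) (X : ptopologicalType)
  (T : X -> X) : Prop :=
  forall (mu : probability (borel X) R), invariant T mu ->
  forall (n : nat) (fs : 'I_n -> X -> R) (eps : R),
    (forall i, continuous (fs i)) -> 0 < eps ->
    exists nu : probability (borel X) R,
      [/\ invariant T nu, finitely_supported nu &
        forall i : 'I_n,
          `| Rintegral mu [set: borel X] (fs i : borel X -> R)
             - Rintegral nu [set: borel X] (fs i : borel X -> R) | < eps].

Definition prod_map (A B : Type) (f : A -> A) (g : B -> B) : A * B -> A * B :=
  fun p => (f p.1, g p.2).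

(* Register the (already existing) pointed structure of a product of pointed
   topological spaces so that the product is found as a ptopologicalType
   (the product topology). *)
Section prod_ptop.
Variables (X1 X2 : ptopologicalType).
HB.instance Definition _ := Pointed.on (X1 * X2)%type.
End prod_ptop.

(* Main.v *)
(* For a closed set [C] of parameters, let [(t, z) |-> (t, exp (2 i pi t) z)] act
   on [C] times the unit circle.  The two systems are given by the partial sums
   [a n] of [sum 1/k!] with [n] even, respectively odd, together with their limit
   [e].  At level [a n] the rotation has period dividing [n!], and since
   [n! (e - a n) <= 1/n], its first [n!] iterates stay uniformly close to those
   at all higher levels.  Collapsing these levels to [a n], discretising and
   averaging over one period therefore turns any invariant measure into a nearby
   finitely supported one.
   The two parameter sets meet only at the irrational [e], so at a periodic
   point of the product the two angles differ, and the real part of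
   [z1 * conj z2] is a coboundary there: its integral vanishes for every
   finitely supported invariant measure.  It is [1] for the diagonal Lebesgue
   measure on the product of the two limit circles. *)
From HB Require Import structures.
Require Import Defs.
From mathcomp Require Import all_boot all_order all_algebra.
From mathcomp Require Import all_classical all_reals all_analysis.
From mathcomp Require Import measurable_realfun ring lra zify.
Set Implicit Arguments. Unset Strict Implicit. Unset Printing Implicit Defensive.
Import Order.TTheory GRing.Theory Num.Theory numFieldNormedType.Exports.
Local Open Scope classical_set_scope.
Local Open Scope ring_scope.

(** * Borel measurability, and boundedness of continuous functions on compact spaces *)

Section borel_facts.
Context {R : realType} {X : ptopologicalType}.

Lemma borel_continuous_measurable (Y : ptopologicalType) (f : X -> Y) :
  continuous f -> measurable_fun [set: borel X] (f : borel X -> borel Y).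
Proof.
move=> /continuousP cf; apply: (@measurability _ _ (borel X) (borel Y) setT f (@open Y) erefl).
move=> _ [A oA <-]; rewrite setTI; apply: sub_sigma_algebra; exact: cf.
Qed.

Lemma borel_continuous_measurableR (f : X -> R) :
  continuous f -> measurable_fun [set: borel X] (f : borel X -> R).
Proof.
move=> /continuousP cf; apply: (measurability _ (measurable_realfun.RGenOpens.measurableE R)).
move=> _ [_ [a [b ->]] <-]; rewrite setTI; apply: sub_sigma_algebra.
by apply: cf; exact: interval_open.
Qed.

Lemma hausdorff_finite_measurable (F : set (borel X)) :
  hausdorff_space X -> finite_set F -> measurable F.
Proof.
move=> hX fF; rewrite -(setCK F); apply: measurableC.
apply: sub_sigma_algebra; apply/closed_openC.
by have /accessible_finite_set_closed := hausdorff_accessible hX; exact.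
Qed.

Lemma compact_continuous_bounded (f : X -> R) : compact [set: X] ->
  continuous f -> exists2 M, 0 < M & forall x, `|f x| <= M.
Proof.
move=> cX cf.
have /compact_bounded[M [_ Mf]] : compact (f @` [set: X]).
  by apply: continuous_compact => //; exact: continuous_subspaceT.
exists (`|M| + 1); first by rewrite ltr_wpDl.
move=> x; apply: Mf; last by exists x.
by rewrite (le_lt_trans (ler_norm _))// ltrDl.
Qed.

End borel_facts.

(** * Integrals of bounded functions and averages of probability measures *)

Section probability_average.
Context d (T : measurableType d) (R : realType).

Lemma bounded_probability_integrable (mu : probability T R) (f : T -> R) M :
  measurable_fun [set: T] f -> (forall x, `|f x| <= M) ->
  mu.-integrable [set: T] (EFin \o f).
Proof.
move=> mf fM; apply: measurable_bounded_integrable => //.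
  by rewrite (le_lt_trans (probability_le1 _ _))// ltry.
exists M; split; first exact: num_real.
by move=> y My x _; exact: le_trans (fM x) (ltW My).
Qed.

Lemma Rintegral_probability_cst (mu : probability T R) (r : R) :
  Rintegral mu [set: T] (cst r) = r.
Proof.
rewrite Rintegral_cst//= [X in fine X](_ : _ = 1%E) ?mulr1//.
exact: probability_setT.
Qed.

Lemma Rintegral_dist (mu : probability T R) (f g : T -> R) e :
  mu.-integrable [set: T] (EFin \o f) ->
  mu.-integrable [set: T] (EFin \o g) ->
  (forall x, `|f x - g x| <= e) ->
  `|Rintegral mu setT f - Rintegral mu setT g| <= e.
Proof.
move=> If Ig fge; rewrite -RintegralB//.
have Ifg : mu.-integrable [set: T] (EFin \o (fun x => f x - g x)).
  by have := integrableB measurableT If Ig.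
apply: (le_trans (le_normr_Rintegral _ Ifg)) => //.
rewrite -[leRHS](Rintegral_probability_cst mu e).
apply: le_Rintegral => //.
- exact: integrable_norm.
- exact: (@bounded_probability_integrable mu (cst e) `|e|).
Qed.

(** Integration is additive in the measure for nonnegative functions; a bounded [f] is brought to
    that case by adding its bound [M]. The existential hides the construction behind the two
    formulas. *)
Lemma probability_average (q : nat) (m : nat -> probability T R) : (0 < q)%N ->
  exists nu : probability T R,
    (forall A, nu A = ((q%:R)^-1)%:E * \sum_(k < q) m k A)%E /\
    (forall (f : T -> R) (M : R), measurable_fun [set: T] f -> (forall x, `|f x| <= M) ->
      Rintegral nu [set: T] f =
      q%:R^-1 * \sum_(k < q) Rintegral (m k) [set: T] f).
Proof.
move=> q0; have iq0 : (0 : R) <= q%:R^-1 by rewrite invr_ge0.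
pose nu0 := mscale (NngNum iq0) (msum (fun k => m k) q).
have nu0T : nu0 setT = 1%E.
  rewrite /nu0 /mscale/= /msum.
  rewrite (eq_bigr (fun=> 1%E)) => [|k _]; last exact: probability_setT.
  rewrite sumEFin -EFinM sumr_const card_ord; congr EFin.
  by rewrite mulVf// pnatr_eq0 -lt0n.
have [nu nuE] : exists nu : probability T R,
      (nu : {measure set T -> \bar R}) = nu0 :> (set T -> \bar R).
  pose mx := Measure_isProbability.Build _ _ _ nu0 nu0T.
  by exists (HB.pack nu0 mx : probability T R).
have ge0E (g : T -> R) M : measurable_fun [set: T] g ->
    (forall x, 0 <= g x <= M) ->
    Rintegral nu [set: T] g =
      q%:R^-1 * \sum_(k < q) Rintegral (m k) [set: T] g.
  move=> mg g0; rewrite /Rintegral nuE /nu0.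
  have mEg : measurable_fun [set: T] (fun x => (g x)%:E) by exact/measurable_EFinP.
  have Eg0 x : (0 <= (g x)%:E)%E by rewrite lee_fin; have /andP[] := g0 x.
  rewrite ge0_integral_mscale//= ge0_integral_measure_sum//.
  have fin k : (\int[m k]_x (g x)%:E)%E \is a fin_num.
    apply: integrable_fin_num => //.
    apply: (@bounded_probability_integrable _ _ M) => // x.
    by have /andP[gx0 gxM] := g0 x; rewrite ger0_norm.
  rewrite fineM//; last by apply/sum_fin_numP => k _ _; exact: fin.
  by rewrite -sum_fine// => k _; exact: fin.
exists nu; split => [A|f M mf fM]; first exact: (congr1 (@^~ A) nuE).
have fMge0 x : 0 <= f x + M <= M + M.
  by have := fM x; rewrite ler_norml => /andP[? ?]; apply/andP; split; lra.
have shift (p : probability T R) :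
    Rintegral p [set: T] f = Rintegral p [set: T] (fun x => f x + M) - M.
  rewrite RintegralD//.
  - by rewrite Rintegral_probability_cst addrK.
  - exact: bounded_probability_integrable fM.
  - exact: (@bounded_probability_integrable _ (cst M) `|M|).
rewrite shift (ge0E _ (M + M))//; last first.
  by apply: measurable_funD.
under [in RHS]eq_bigr do rewrite shift.
rewrite sumrB mulrBr sumr_const card_ord; congr (_ - _).
by rewrite -[M *+ q]mulr_natl mulKf// pnatr_eq0 -lt0n.
Qed.

End probability_average.

(** * From rigidity to density of periodic measures *)

Section periodic_approximation.
Context {R : realType} {X : ptopologicalType}.

(* Points are grouped according to which thresholds of a fine grid the values
   of the [g i] lie below, and each class is collapsed to one of its points. *)
Lemma finite_range_approximation (I : finType) (g : I -> X -> R) (e : R) :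
  compact [set: X] -> (forall i, continuous (g i)) -> 0 < e ->
  exists D : borel X -> borel X,
    [/\ measurable_fun [set: borel X] D, finite_set (range D) &
        forall i x, `|g i (D x) - g i x| <= e].
Proof.
move=> cX cg e0.
have [B B0 gB] : exists2 B, 0 < B & forall i x, `|g i x| <= B.
  have /choice[b bP] : forall i, exists b, 0 < b /\ forall x, `|g i x| <= b.
    by move=> i; have [b b0 gb] := compact_continuous_bounded cX (cg i); exists b.
  exists (1 + \sum_i b i).
    by rewrite ltr_wpDr// sumr_ge0// => i _; have [/ltW] := bP i.
  move=> i x; have [_ /(_ x)/le_trans] := bP i; apply.
  rewrite (bigD1 i)//= addrCA lerDl addr_ge0// sumr_ge0// => j _.
  by have [/ltW] := bP j.
pose c k : R := - B + k%:R * e.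
pose M := (Num.truncn ((B + B) / e)).+1.
pose G (x : borel X) := [ffun p : I * 'I_M.+1 => g p.1 x < c p.2].
have Gclose x y i : G x = G y -> g i y - e <= g i x.
  move=> Gxy; rewrite leNgt; apply/negP => xy.
  have /andP[gB1 gB2] : - B <= g i x <= B by rewrite -ler_norml.
  (* The first threshold [c k] above [g i x] exceeds it by at most [e], so it would separate [x]
     from [y]. *)
  pose z := (g i x + B) / e.
  have z0 : 0 <= z by apply: divr_ge0; [lra|exact: ltW].
  pose k := (Num.truncn z).+1.
  have xk : g i x < c k.
    by have := truncnS_gt z; rewrite ltr_pdivrMr// /c /k; lra.
  have kx : c k <= g i x + e.
    have : (Num.truncn z)%:R <= z by rewrite truncn_le.
    by rewrite ler_pdivlMr// /c /k -natr1; lra.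
  have kM : (k < M.+1)%N.
    rewrite !ltnS truncn_le_nat; apply: le_lt_trans (truncnS_gt _).
    by rewrite ler_pM2r ?invr_gt0//; lra.
  have := congr1 (fun f : {ffun _} => f (i, Ordinal kM)) Gxy.
  by rewrite !ffunE/= xk => /esym; lra.
(* For a pattern [v] realised by no point, [get] returns the default point; [D] evaluates [cell]
   only at patterns [G x]. *)
pose cell v := get [set y : borel X | G y = v].
have GD x : G (cell (G x)) = G x.
  by apply: (@getPex _ [set y : borel X | G y = G x]); exists x.
have mG v : measurable (G @^-1` [set v]).
  have -> : G @^-1` [set v] =
      \bigcap_(p in [set: I * 'I_M.+1]) [set x | (g p.1 x < c p.2) = v p].
    apply/seteqP; split=> [x /= Gxv p _ /=|x /= xv]; first by rewrite -Gxv ffunE.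
    by apply/ffunP => p; rewrite ffunE; exact: xv.
  apply: fin_bigcap_measurable => // p _.
  have mlt : measurable [set x : borel X | g p.1 x < c p.2].
    rewrite -[X in measurable X]setTI.
    have -> : [set x | g p.1 x < c p.2] = g p.1 @^-1` `]-oo, c p.2[%classic.
      by apply/seteqP; split=> x /=; rewrite in_itv.
    exact: borel_continuous_measurableR.
  case: (v p) => //.
  rewrite (_ : [set x | _] = ~` [set x : borel X | g p.1 x < c p.2]).
    exact: measurableC.
  by apply/seteqP; split=> x /=; [move=> -> | move/negP/negbTE].
exists (cell \o G); split.
- move=> _ A mA; rewrite setTI.
  have -> : (cell \o G) @^-1` A =
      \bigcup_(v in [set v | A (cell v)]) (G @^-1` [set v]).
    by apply/seteqP; split=> [x /= Ax|x [v /= Av Gxv]]; [exists (G x)|rewrite /= Gxv].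
  by apply: fin_bigcup_measurable => // v _; exact: mG.
- apply: (@sub_finite_set _ _ (cell @` setT)).
    by move=> _ [x _ <-]; exists (G x).
  exact: finite_image.
- move=> i x /=; rewrite ler_norml; apply/andP; split.
    by have := Gclose _ _ i (GD x); lra.
  by have := Gclose _ _ i (esym (GD x)); lra.
Qed.

Lemma Rintegral_distribution d d' (T : measurableType d)
    (T' : measurableType d') (mu : probability T R) (S : {mfun T >-> T'})
    (f : T' -> R) (M : R) :
  measurable_fun [set: T'] f -> (forall x, `|f x| <= M) ->
  Rintegral (distribution mu S) [set: T'] f = Rintegral mu [set: T] (f \o S).
Proof.
move=> mf fM; rewrite /Rintegral integral_distribution//.
  exact/measurable_EFinP.
apply: (@bounded_probability_integrable _ _ _ _ (f \o S) M) => [|x /=] //.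
exact: measurableT_comp.
Qed.

Lemma invariant_Rintegral (mu : probability (borel X) R) (T : X -> X)
    (f : borel X -> R) (M : R) : continuous T -> Defs.invariant T mu ->
  measurable_fun [set: borel X] f -> (forall x, `|f x| <= M) ->
  Rintegral mu [set: borel X] (f \o T) = Rintegral mu [set: borel X] f.
Proof.
move=> /borel_continuous_measurable mT muT mf fM.
pose Tm : {mfun borel X >-> borel X} :=
  HB.pack (T : borel X -> borel X) (isMeasurableFun.Build _ _ _ _ _ mT).
rewrite -(Rintegral_distribution mu Tm mf fM) /Rintegral; congr fine.
by apply: eq_measure_integral => A mA _; exact: muT.
Qed.

Lemma continuous_iter (T : X -> X) k : continuous T -> continuous (iter k T).
Proof.
move=> cT; elim: k => [|k IH] x; first exact: cvg_id.
by apply: (@continuous_comp _ _ _ (iter k T) T); [exact: IH|exact: cT].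
Qed.

Lemma invariant_Rintegral_iter (mu : probability (borel X) R) (T : X -> X)
    (f : X -> R) k : compact [set: X] -> continuous f ->
  continuous T -> Defs.invariant T mu ->
  Rintegral mu [set: borel X] (f \o iter k T) = Rintegral mu [set: borel X] f.
Proof.
move=> cX cf cT muT; elim: k => // k IH.
have cfk : continuous (f \o iter k T).
  by move=> x; apply: continuous_comp; [exact: continuous_iter|exact: cf].
have [M M0 fM] := compact_continuous_bounded cX cfk.
rewrite -[RHS]IH -[RHS](@invariant_Rintegral mu T _ M)//.
  by apply: eq_Rintegral => x _ /=; rewrite -iterSr.
exact: borel_continuous_measurableR.
Qed.

(** [P] sends each point to one of period dividing [q] whose first [q] iterates shadow those of the
    original point, as far as the [fs] can see. Composing [P] with a finite-range map [D] and
    averaging the images of [mu] along the [q] iterates gives the periodic measure. *)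
Lemma rigid_dense_periodic_measures (T : X -> X) :
  compact [set: X] -> hausdorff_space X -> continuous T ->
  (forall (n : nat) (fs : 'I_n -> X -> R) (eps : R),
    (forall i, continuous (fs i)) -> 0 < eps ->
    exists (q : nat) (P : X -> X),
      [/\ (0 < q)%N, continuous P, forall x, iter q T (P x) = P x &
        forall i k x, (k < q)%N ->
          `|fs i (iter k T (P x)) - fs i (iter k T x)| <= eps]) ->
  dense_periodic_measures R T.
Proof.
move=> cX hX cT rigid mu muT n fs eps cfs eps0.
(* One quarter is lost to [P] and one to [D]; the remaining half makes the final inequality
   strict. *)
have e4 : 0 < eps / 4 by rewrite divr_gt0.
have [q [P [q0 cP TqP close]]] := rigid n fs _ cfs e4.
(* A single discretisation serves all test functions along all [q] iterates at once. *)
have [|D [mD fD Dclose]] := @finite_range_approximation ('I_n * 'I_q)%type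
    (fun p => fs p.1 \o iter p.2 T \o P) _ cX _ e4.
  move=> p x; apply: continuous_comp; first exact: cP.
  by apply: continuous_comp; [exact: continuous_iter|exact: cfs].
pose phi k : borel X -> borel X := fun x => iter k T (P (D x)).
have mphi k : measurable_fun [set: borel X] (phi k).
  apply: (@measurableT_comp _ _ _ _ _ _ (iter k T \o P : borel X -> borel X)) => //.
  apply: borel_continuous_measurable => x.
  by apply: continuous_comp; [exact: cP|exact: continuous_iter].
pose Phi k : {mfun borel X >-> borel X} :=
  HB.pack (phi k) (isMeasurableFun.Build _ _ _ _ _ (mphi k)).
have [nu [nuE nuI]] := probability_average (fun k => distribution mu (Phi k)) q0.
have q_neq0 : q%:R != 0 :> R by rewrite pnatr_eq0 -lt0n.
exists nu; split.
- move=> A mA; rewrite !nuE; congr (_ * _)%E.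
  case: q {Dclose nu nuE nuI close q_neq0} q0 TqP => // q _ TqP.
  (* Taking preimages under [T] turns the [k]-th image measure into the next one; the last returns
     to the first because [iter q T] fixes the range of [P]. *)
  rewrite big_ord_recr big_ord_recl addeC; congr (_ + _)%E => //.
  rewrite /distribution /pushforward /=; congr (mu _).
  by apply/seteqP; split=> x /=; rewrite /phi -[T (iter q T _)]/(iter q.+1 T _) TqP.
- have fF : finite_set (\bigcup_(k in `I_q) range (phi k)).
    apply: bigcup_finite => // k _.
    have -> : range (phi k) = (iter k T \o P) @` range D.
      apply/seteqP; split=> [_ [x _ <-]|_ [_ [x _ <-] <-]]; last by exists x.
      by exists (D x) => //; exists x.
    exact: finite_image.
  have mF := hausdorff_finite_measurable hX fF.
  exists (\bigcup_(k in `I_q) range (phi k)); split => //.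
  rewrite nuE (eq_bigr (fun=> 1%E)) => [|k _].
    rewrite sumEFin -EFinM sumr_const card_ord.
    by rewrite mulVf.
  transitivity (mu [set: borel X]); last exact: probability_setT.
  congr (mu _).
  by apply/seteqP; split=> x // _; exists k => //=; exists x.
- move=> i; have [M M0 fM] := compact_continuous_bounded cX (cfs i).
  have mf := borel_continuous_measurableR (cfs i).
  rewrite (nuI _ _ mf fM).
  have intE k (kq : (k < q)%N) : `|Rintegral mu [set: borel X] (fs i)
      - Rintegral (distribution mu (Phi k)) [set: borel X] (fs i)| <= eps / 2.
    rewrite (Rintegral_distribution mu (Phi k) mf fM).
    (* Invariance of [mu] allows [fs i] to be replaced by [fs i \o iter k T], which is the function
       that [fs i \o phi k] approximates. *)
    rewrite -(invariant_Rintegral_iter k cX (cfs i) cT muT).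
    have mfk : measurable_fun [set: borel X] (fs i \o iter k T).
      apply: borel_continuous_measurableR => x.
      by apply: continuous_comp; [exact: continuous_iter|exact: cfs].
    apply: Rintegral_dist.
    + exact: (bounded_probability_integrable mu mfk (fun x => fM _)).
    + apply: (@bounded_probability_integrable _ _ _ mu
        (fs i \o phi k) M) => [|x /=]; last exact: fM.
      exact: measurableT_comp.
    + move=> x /=; rewrite /phi.
      have := Dclose (i, Ordinal kq) x; have := close i k x kq => /=.
      rewrite !ler_norml => /andP[? ?] /andP[? ?]; apply/andP; split; lra.
  set I := Rintegral mu _ _; set J := BIG_F.
  have -> : I - q%:R^-1 * \sum_(k < q) J k = q%:R^-1 * \sum_(k < q) (I - J k).
    by rewrite sumrB sumr_const card_ord mulrBr -[I *+ q]mulr_natl mulKf.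
  rewrite normrM ger0_norm ?invr_ge0//; apply: (@le_lt_trans _ _ (eps / 2)); last lra.
  rewrite ler_pdivrMl ?ltr0n//; apply: (le_trans (ler_norm_sum _ _ _)).
  rewrite mulr_natl -[X in _ *+ X]card_ord -sumr_const; apply: ler_sum => k _.
  exact: intE.
Qed.

End periodic_approximation.

(** * The number e and the partial sums of its series *)

Section euler_number.
Context {R : realType}.

Definition inv_fact_sum (n : nat) : R := \sum_(k < n.+1) (k`!%:R)^-1.
(** As a supremum of increasing sums, e is bounded above by any common bound of the sums. *)
Definition euler : R := sup (range inv_fact_sum).

Local Notation a := inv_fact_sum.

Lemma inv_fact_sumS n : a n.+1 = a n + (n.+1)`!%:R^-1.
Proof. by rewrite /a big_ord_recr. Qed.

Lemma inv_fact_sum2 : a 2 = 5 / 2.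
Proof.
rewrite !inv_fact_sumS /a big_ord1 (_ : 0`! = 1)%N// (_ : 1`! = 1)%N//.
by rewrite (_ : 2`! = 2)%N//; lra.
Qed.

Lemma ltr_inv_fact_sum : {homo a : i j / (i < j)%N >-> i < j}.
Proof.
apply: homo_ltn => [y x z|n]; first exact: lt_trans.
by rewrite inv_fact_sumS ltrDl invr_gt0 ltr0n fact_gt0.
Qed.

Lemma ler_inv_fact_sum : {homo a : i j / (i <= j)%N >-> i <= j}.
Proof. exact/ltW_homo/ltr_inv_fact_sum. Qed.

Lemma inv_fact_sum_inj : injective a.
Proof.
move=> i j aij; case: (ltngtP i j) => // /ltr_inv_fact_sum.
  by rewrite aij ltxx.
by rewrite aij ltxx.
Qed.

(** Each [k!] with [k <= n] divides [n!]. Hence [n!] is a period of the rotation by [a m] turns. *)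
Lemma fact_inv_fact_sum_int m n : (m <= n)%N ->
  n`!%:R * a m \is a Num.int.
Proof.
move=> mn; rewrite /a mulr_sumr; apply: rpred_sum => k _.
have kn : (k <= n)%N by rewrite (leq_trans _ mn)// -ltnS.
have : (k`! %| n`!)%N by rewrite -(bin_fact kn) mulnCA dvdn_mulr.
move=> /dvdnP[c ->].
by rewrite natrM mulfK ?pnatr_eq0 -?lt0n ?fact_gt0// rpred_nat.
Qed.

(* [a n + 1 / (n n!)] decreases, hence bounds [a] from above. *)
Lemma inv_fact_sum_le m n : (0 < n)%N -> a m <= a n + (n%:R * n`!%:R)^-1.
Proof.
move=> n0; pose b k := a k + (k%:R * k`!%:R)^-1.
have b_ge k : a k <= b k by rewrite lerDl invr_ge0 mulr_ge0.
have b_noninc k : (0 < k)%N -> b k.+1 <= b k.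
  move=> k0; rewrite /b inv_fact_sumS -addrA lerD2l factS natrM -natr1.
  have : 0 < k%:R :> R by rewrite ltr0n.
  have : 0 < k`!%:R :> R by rewrite ltr0n fact_gt0.
  move: (k%:R) (k`!%:R) => x f f0 x0.
  have x1 : 0 < x + 1 by lra.
  rewrite -subr_ge0.
  have -> : (x * f)^-1 - (((x + 1) * f)^-1 + ((x + 1) * ((x + 1) * f))^-1)
     = (x * (x + 1) ^+ 2 * f)^-1 by field; rewrite !gt_eqF.
  by rewrite invr_ge0 !mulr_ge0 ?sqr_ge0// ltW.
have [mn|nm] := leqP m n.
  by rewrite (le_trans (ler_inv_fact_sum mn))// b_ge.
apply: (le_trans (b_ge m)); rewrite -(subnKC (ltnW nm)).
elim: (m - n)%N => [|d IH]; first by rewrite addn0.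
by rewrite addnS (le_trans (b_noninc _ _))// addn_gt0 n0.
Qed.

Lemma has_sup_inv_fact_sum : has_sup (range a).
Proof.
split; first by exists (a 0); exists 0%N.
by exists (a 1 + (1%:R * 1`!%:R)^-1) => _ [n _ <-]; exact: inv_fact_sum_le.
Qed.

Lemma inv_fact_sum_lt_euler n : a n < euler.
Proof.
apply: (lt_le_trans (ltr_inv_fact_sum (ltnSn n))).
by apply: ub_le_sup; [case: has_sup_inv_fact_sum|exists n.+1].
Qed.

Lemma euler_le n : (0 < n)%N -> euler <= a n + (n%:R * n`!%:R)^-1.
Proof.
move=> n0; apply: ge_sup; first by case: has_sup_inv_fact_sum.
by move=> _ [m _ <-]; exact: inv_fact_sum_le.
Qed.

(** This is the rigidity estimate: over [n!] steps, the rotations by e and by [a n] drift apart by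
    at most [1/n] of a turn. *)
Lemma fact_euler_sub_le n : (0 < n)%N -> n`!%:R * (euler - a n) <= n%:R^-1.
Proof.
move=> n0; rewrite mulrC -ler_pdivlMr ?ltr0n ?fact_gt0// lerBlDl -invfM.
exact: euler_le.
Qed.

Lemma inv_fact_sum_to_euler t : t < euler -> exists n, t < a n.
Proof.
move=> /(sup_gt _)[]; first by case: has_sup_inv_fact_sum.
by move=> _ [n _ <-]; exists n.
Qed.

Lemma euler_lt3 : euler < 3.
Proof.
apply: le_lt_trans (euler_le (isT : 0 < 2)%N) _.
by rewrite inv_fact_sum2 (_ : 2`! = 2)%N//; lra.
Qed.

(** Otherwise [n! (e - a n)] would be an integer strictly between 0 and 1. The form with multiples
    is what a periodic point on the limit circle contradicts. *)
Lemma euler_irrational m : (0 < m)%N -> m%:R * euler \isn't a Num.int.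
Proof.
move=> m0; apply/negP => me.
(* The successor ensures [n >= 2], hence [1/n < 1], even when [m = 1]. *)
pose n := m.+1.
have ne : n`!%:R * euler \is a Num.int.
  rewrite /n factS natrM -mulrA rpredM ?rpred_nat//.
  have /dvdnP[c ->] : (m %| m`!)%N by rewrite dvdn_fact// m0 leqnn.
  by rewrite natrM -mulrA rpredM ?rpred_nat.
have : n`!%:R * (euler - a n) \is a Num.int.
  by rewrite mulrBr rpredB// fact_inv_fact_sum_int.
move/intrP => [z zE].
have : 0 < n`!%:R * (euler - a n).
  by rewrite mulr_gt0 ?ltr0n ?fact_gt0// subr_gt0 inv_fact_sum_lt_euler.
have : n`!%:R * (euler - a n) < 1.
  apply: le_lt_trans (fact_euler_sub_le _) _ => //.
  by rewrite invf_lt1 ?ltr0n// ltr1n.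
by rewrite zE ltrz1 ltr0z; lia.
Qed.

End euler_number.

(** * Plane rotations in real coordinates *)

Section rotations.
Context {R : realType}.
Implicit Types (x y : R) (z : R * R).

Definition plane_rot x z : R * R :=
  (cos x * z.1 - sin x * z.2, sin x * z.1 + cos x * z.2).

Lemma plane_rotD x y z : plane_rot (x + y) z = plane_rot x (plane_rot y z).
Proof. by rewrite /plane_rot /= cosD sinD; congr (_, _); ring. Qed.

Lemma plane_rot0 z : plane_rot 0 z = z.
Proof. by case: z => u v; rewrite /plane_rot /= cos0 sin0; congr (_, _); ring. Qed.

Lemma sqr_plane_rot x z : (plane_rot x z).1 ^+ 2 + (plane_rot x z).2 ^+ 2 = z.1 ^+ 2 + z.2 ^+ 2.
Proof.
have cs := cos2Dsin2 x.
transitivity ((cos x ^+ 2 + sin x ^+ 2) * (z.1 ^+ 2 + z.2 ^+ 2)).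
  by rewrite /plane_rot /=; ring.
by rewrite cs mul1r.
Qed.

Lemma cos_sin_2pi_int x : x \is a Num.int ->
  cos (pi *+ 2 * x) = 1 /\ sin (pi *+ 2 * x) = 0.
Proof.
have nat_case n : cos (pi *+ 2 * n%:R) = 1 :> R /\ sin (pi *+ 2 * n%:R) = 0 :> R.
  rewrite mulr_natr -[(pi *+ 2) *+ n]add0r.
  by rewrite (periodicn (@cosD2pi R)) (periodicn (@sinD2pi R)) cos0 sin0.
move=> /intrP[[n|n] ->]; first exact: nat_case.
have [c s] := nat_case n.+1.
by rewrite NegzE mulrNz mulrN cosN sinN c s oppr0.
Qed.

Lemma plane_rot_2pi_int x z : x \is a Num.int -> plane_rot (pi *+ 2 * x) z = z.
Proof.
by move=> /cos_sin_2pi_int[c s]; rewrite -[RHS]plane_rot0 /plane_rot c s cos0 sin0.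
Qed.

(** By the double-angle formula the cosine is [1 - 2 sin^2 (pi x)], and this sine is positive. *)
Lemma cos_2pi_lt1 x : 0 < x < 1 -> cos (pi *+ 2 * x) < 1.
Proof.
move=> /andP[x0 x1]; have p0 := @pi_gt0 R.
have s0 : 0 < sin (pi * x).
  by rewrite sin_gt0_pi// mulr_gt0//= -[ltRHS]mulr1 ltr_pM2l.
by rewrite mulrnAl cos_mulr2n cos2sin2; nra.
Qed.

Lemma cos_2pi_eq1 x : cos (pi *+ 2 * x) = 1 -> x \is a Num.int.
Proof.
move=> cx; pose f := x - (Num.floor x)%:~R.
have [c s] := cos_sin_2pi_int (intr_int R (Num.floor x)).
have cf : cos (pi *+ 2 * f) = 1 by rewrite mulrBr cosB c s cx; ring.
have /andP[fx xf] := floor_itv x.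
have : 0 <= f by rewrite subr_ge0.
rewrite le_eqVlt => /predU1P[/esym/subr0_eq -> //|f0].
have := @cos_2pi_lt1 f; rewrite f0/= cf ltxx => H.
suff f1 : f < 1 by have := H f1.
by rewrite /f; move: xf; rewrite intrD; lra.
Qed.

Lemma cos_dist x y : `|cos x - cos y| <= `|x - y|.
Proof.
wlog xy : x y / x <= y.
  have [|/ltW yx] := leP x y; first by move=> ? ->.
  by move=> /(_ y x yx); rewrite distrC [in leRHS]distrC.
have [|c _ cE] := @MVT_segment R (@cos R) (fun t => - sin t) x y xy.
  by apply: continuous_subspaceT; exact: continuous_cos.
by rewrite distrC cE normrM normrN distrC ler_piMl ?normr_ge0// sin_max.
Qed.

Lemma sin_dist x y : `|sin x - sin y| <= `|x - y|.
Proof. by rewrite -!cosBpihalf (le_trans (cos_dist _ _))// opprB addrA subrK. Qed.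

(** Sine and cosine are 1-Lipschitz and the coordinates of [z] are at most 1, so each of the two
    terms contributes one [|x - y|]. *)
Lemma plane_rot_dist x y z : z.1 ^+ 2 + z.2 ^+ 2 = 1 ->
  `|(plane_rot x z).1 - (plane_rot y z).1| <= 2 * `|x - y| /\
  `|(plane_rot x z).2 - (plane_rot y z).2| <= 2 * `|x - y|.
Proof.
case: z => u v /= uv1.
have u1 : `|u| <= 1 by rewrite -(@expr_le1 _ 2)// real_normK ?num_real//; nra.
have v1 : `|v| <= 1 by rewrite -(@expr_le1 _ 2)// real_normK ?num_real//; nra.
have c := cos_dist x y; have s := sin_dist x y.
split.
- rewrite (_ : _ - _ = (cos x - cos y) * u - (sin x - sin y) * v); last ring.
  rewrite (le_trans (ler_normB _ _))// !normrM mulr_natl mulr2n.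
  by apply: lerD; rewrite -[leRHS]mulr1 ler_pM.
- rewrite (_ : _ - _ = (sin x - sin y) * u + (cos x - cos y) * v); last ring.
  rewrite (le_trans (ler_normD _ _))// !normrM mulr_natl mulr2n.
  by apply: lerD; rewrite -[leRHS]mulr1 ler_pM.
Qed.

End rotations.

(** * Subspace topology and uniform continuity *)

Section set_type_topology.
Context {X : topologicalType} (A : set X).

Lemma set_type_continuous {Y : topologicalType} (f : Y -> A) :
  continuous (set_val \o f) -> continuous f.
Proof. exact: continuous_comp_initial. Qed.

Lemma continuous_set_val : continuous (set_val : A -> X).
Proof. exact: initial_continuous. Qed.

Lemma set_type_hausdorff : hausdorff_space X -> hausdorff_space A.
Proof.
move=> hX p q clpq; apply: val_inj; apply: hX => U V nU nV.
have [x [Ux Vx]] := clpq _ _ (@continuous_set_val p _ nU) (@continuous_set_val q _ nV).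
by exists (set_val x).
Qed.

(** A proper filter on the subtype is pushed to [X], where it contains [A] and clusters at a point
    of [A]. Open sets of the subtype are traces of open sets, so the cluster point lifts. *)
Lemma set_type_compact : compact A -> compact [set: A].
Proof.
move=> cA F PF _.
have GA : (set_val @ F) A.
  by apply: (@filterS _ F _ setT) => [x _ /=|]; [exact: set_valP|exact: filterT].
have [x [Ax clx]] := cA _ (fmap_proper_filter set_val PF) GA.
exists (exist _ x (mem_set Ax) : A); split => // B V FB [W [[U oU <-] Ux UV]].
have FB' : F (set_val @^-1` (set_val @` B)) by apply: filterS FB => c Bc; exists c.
have [y [[b Bb <-] Ub]] := clx _ _ FB' (open_nbhs_nbhs (conj oU Ux)).
by exists b; split => //; exact: UV.
Qed.

End set_type_topology.

(** Near each point some [r / 2] bounds both the displacement and [d]; compactness makes the range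
    of [d] global. Saying it for all small [d] lets finitely many functions share one radius. *)
Lemma uniform_continuity (R : realType) (X : pseudoMetricType R) (f : X -> R)
    (e : R) : compact [set: X] -> continuous f -> 0 < e ->
  \forall d \near 0^'+, forall x y, ball x d y -> `|f x - f y| < e.
Proof.
move=> cX cf e0.
have /compact_near_coveringP/(_ R (0^'+)
  (fun d x => forall y, ball x d y -> `|f x - f y| < e)) := cX.
move=> cover.
suff /cover : forall x : X, [set: X] x -> \forall x' \near x & d \near 0^'+,
    forall y, ball x' d y -> `|f x' - f y| < e.
  by apply: filterS => d dP x y; exact: dP.
move=> x _.
have /cvgrPdist_lt/(_ (e / 2)) := cf x; rewrite divr_gt0// => /(_ isT).
move=> /nbhs_ballP[r /= r0 rP].
exists (ball x (r / 2), `]0, r / 2[%classic).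
  split => /=; first by apply: nbhsx_ballx; rewrite divr_gt0.
  by near=> d; rewrite /= in_itv/=; apply/andP; split; near: d;
    [exact: nbhs_right_gt|apply: nbhs_right_lt; rewrite divr_gt0].
move=> [x' d] [/= xx']; rewrite in_itv/= => /andP[d0 dr] y x'y.
have h1 : `|f x - f x'| < e / 2.
  by apply: rP; apply: le_ball xx'; rewrite ler_pdivrMr//; lra.
have h2 : `|f x - f y| < e / 2.
  apply: rP; rewrite (splitr r); apply: ball_triangle xx' _.
  by apply: le_ball x'y; exact: ltW.
by move: h1 h2; rewrite !ltr_norml => /andP[? ?] /andP[? ?]; apply/andP; split; lra.
Unshelve. all: by end_near. Qed.

(** * The two closed parameter sets *)

Section levels.
Context {R : realType}.
Variable b : bool.

(* Starting at index 2 puts all levels in [5/2, 3), where distinct parameters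
   differ by less than 1 and so give distinct rotations. *)
Definition level_index (n : nat) : nat := (n.*2 + b).+2.
Definition level (n : nat) : R := inv_fact_sum (level_index n).

(* The levels of parity [b] together with their limit; phrasing this with
   weak inequalities makes closedness immediate. *)
Definition levels : set R := [set t | level 0 <= t <= euler /\
  forall n, t <= level n \/ level n.+1 <= t].

Lemma level_lt_euler n : level n < euler.
Proof. exact: inv_fact_sum_lt_euler. Qed.

Lemma level_le : {homo level : i j / (i <= j)%N >-> i <= j}.
Proof.
by move=> i j ij; apply: ler_inv_fact_sum; rewrite !ltnS leq_add2r leq_double.
Qed.

Lemma levels_euler : levels euler.
Proof.
split; first by rewrite lexx (ltW (level_lt_euler 0)).
by move=> n; right; rewrite ltW// level_lt_euler.
Qed.

(** Capping a parameter at [level n] is how the higher levels get collapsed; the result must stay in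
    the parameter set. *)
Lemma levels_min t n : levels t -> levels (Num.min t (level n)).
Proof.
move=> [/andP[t0 te] tn]; split=> [|m].
  by rewrite le_min t0 level_le//= ge_min te.
have [mn|nm] := leqP n m; first by left; rewrite ge_min (level_le mn) orbT.
have [tm|mt] := tn m; first by left; rewrite ge_min tm.
by right; rewrite le_min mt level_le.
Qed.

(** Going down from [n], the gap condition leaves either equality with the current level or a
    parameter below the previous one. *)
Lemma levels_eq_level t n : levels t -> t <= level n ->
  exists2 m, (m <= n)%N & t = level m.
Proof.
move=> [/andP[t0 te] tn]; elim: n => [t0'|n IH tSn].
  by exists 0%N => //; apply/le_anti; rewrite t0 t0'.
have [/IH[m mn ->]|nt] := tn n; first by exists m => //; exact: leqW.
by exists n.+1 => //; apply/le_anti; rewrite tSn nt.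
Qed.

Lemma closed_levels : closed levels.
Proof.
have -> : levels = ([set t | level 0 <= t] `&` [set t | t <= euler]) `&`
    \bigcap_(n in [set: nat]) ([set t | t <= level n] `|` [set t | level n.+1 <= t]).
  apply/seteqP; split=> t /=.
    by move=> [/andP[? ?] tn]; split => // n _; exact: tn.
  by move=> [[t0 te] tn]; split=> [|n]; [rewrite t0 te|exact: tn].
apply: closedI; first by apply: closedI; [exact: closed_ge|exact: closed_le].
apply: closed_bigI => n _.
by apply: closedU; [exact: closed_le|exact: closed_ge].
Qed.

Lemma levels_itv t : levels t -> 5 / 2 <= t < 3.
Proof.
move=> [/andP[t0 te] _]; rewrite (le_lt_trans te euler_lt3) andbT.
by rewrite (le_trans _ t0)// -inv_fact_sum2 ler_inv_fact_sum.
Qed.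

Lemma level_period_int m n : (m <= n)%N ->
  (level_index n)`!%:R * level m \is a Num.int.
Proof.
by move=> mn; apply: fact_inv_fact_sum_int; rewrite !ltnS leq_add2r leq_double.
Qed.

Lemma level_rigid n :
  (level_index n)`!%:R * (euler - level n) <= (level_index n)%:R^-1.
Proof. exact: fact_euler_sub_le. Qed.

End levels.

(** A common parameter below e would be a partial sum of both even and odd index, while the partial
    sums are distinct. *)
Lemma levels_cap (R : realType) (t : R) :
  levels false t -> levels true t -> t = euler.
Proof.
move=> l0 l1; have [/andP[_ te] _] := l0; apply/eqP; rewrite eq_le te /= leNgt.
apply/negP => /inv_fact_sum_to_euler[n tn].
have tl (b : bool) : t <= level b n.
  by rewrite (le_trans (ltW tn))// ler_inv_fact_sum// /level_index; lia.
have [i _ ti] := levels_eq_level l0 (tl _).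
have [j _ tj] := levels_eq_level l1 (tl _).
have /inv_fact_sum_inj : level false i = level true j :> R by rewrite -ti -tj.
by rewrite /level_index; lia.
Qed.

(** * The circle bundle over the levels and its rotation *)

Section rotation_space.
Context {R : realType}.
Variable b : bool.

Definition circle_bundle : set (R * (R * R)) :=
  [set p | levels b p.1 /\ p.2.1 ^+ 2 + p.2.2 ^+ 2 = 1].

(** A separate name for the subtype, which then receives a base point on the limit circle. *)
Definition rotation_space : Type := set_type circle_bundle.
HB.instance Definition _ := PseudoMetric.on rotation_space.

Lemma circle_bundle_point x : circle_bundle (euler, (cos x, sin x)).
Proof. by split => /=; [exact: levels_euler|exact: cos2Dsin2]. Qed.

Definition euler_point x : rotation_space :=
  exist (fun p => p \in circle_bundle) _ (mem_set (circle_bundle_point x)).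

HB.instance Definition _ := isPointed.Build rotation_space (euler_point 0).

(** Defined on the whole ambient space, where continuity and inversion are proved before
    restricting. *)
Definition twist (p : R * (R * R)) := (p.1, plane_rot (pi *+ 2 * p.1) p.2).

Lemma circle_bundle_twist p : circle_bundle p -> circle_bundle (twist p).
Proof. by move=> [? ?]; split => //=; rewrite sqr_plane_rot. Qed.

Definition untwist (p : R * (R * R)) := (p.1, plane_rot (- (pi *+ 2 * p.1)) p.2).

Lemma circle_bundle_untwist p : circle_bundle p -> circle_bundle (untwist p).
Proof. by move=> [? ?]; split => //=; rewrite sqr_plane_rot. Qed.

Definition rotation (p : rotation_space) : rotation_space :=
  exist (fun p => p \in circle_bundle) _ (mem_set (circle_bundle_twist (set_valP p))).

Definition rotation_inv (p : rotation_space) : rotation_space :=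
  exist (fun p => p \in circle_bundle) _ (mem_set (circle_bundle_untwist (set_valP p))).

Lemma twistK : cancel twist untwist.
Proof. by case=> t z; rewrite /twist /untwist /= -plane_rotD addNr plane_rot0. Qed.

Lemma untwistK : cancel untwist twist.
Proof. by case=> t z; rewrite /twist /untwist /= -plane_rotD addrN plane_rot0. Qed.

Lemma rotationK : cancel rotation rotation_inv.
Proof. by move=> p; apply: val_inj; exact: twistK. Qed.

Lemma rotation_invK : cancel rotation_inv rotation.
Proof. by move=> p; apply: val_inj; exact: untwistK. Qed.

End rotation_space.

(** * Topology and rigidity of each rotation system *)

Section rotation_dynamics.
Context {R : realType}.
Variable b : bool.
Local Notation space := (@rotation_space R b).

Lemma continuous_rotate (g : R -> R) : continuous g ->
  continuous (fun p : R * (R * R) => (p.1, plane_rot (g p.1) p.2)).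
Proof.
move=> cg p.
have c1 : continuous (fun p : R * (R * R) => p.1) by move=> q; exact: cvg_fst.
have c2 : continuous (fun p : R * (R * R) => p.2) by move=> q; exact: cvg_snd.
have cu : continuous (fun p : R * (R * R) => p.2.1).
  by move=> q; apply: continuous_comp; [exact: c2|exact: cvg_fst].
have cv : continuous (fun p : R * (R * R) => p.2.2).
  by move=> q; apply: continuous_comp; [exact: c2|exact: cvg_snd].
have cgp : continuous (fun p : R * (R * R) => g p.1).
  by move=> q; apply: continuous_comp; [exact: c1|exact: cg].
have cc : continuous (fun p : R * (R * R) => cos (g p.1)).
  by move=> q; apply: continuous_comp; [exact: cgp|exact: continuous_cos].
have cs : continuous (fun p : R * (R * R) => sin (g p.1)).
  by move=> q; apply: continuous_comp; [exact: cgp|exact: continuous_sin].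
have r1 : continuous (fun p : R * (R * R) => (plane_rot (g p.1) p.2).1).
  by move=> q; apply: cvgB; apply: cvgM; [exact: cc|exact: cu|exact: cs|exact: cv].
have r2 : continuous (fun p : R * (R * R) => (plane_rot (g p.1) p.2).2).
  by move=> q; apply: cvgD; apply: cvgM; [exact: cs|exact: cu|exact: cc|exact: cv].
exact: (cvg_pair (c1 p) (cvg_pair (r1 p) (r2 p))).
Qed.

Lemma continuous_rotation : continuous (@rotation R b).
Proof.
apply: set_type_continuous => p.
apply: (@continuous_comp _ _ _ set_val (@twist R)).
  exact: continuous_set_val.
by apply: continuous_rotate => t; exact: mulrl_continuous.
Qed.

Lemma continuous_rotation_inv : continuous (@rotation_inv R b).
Proof.
apply: set_type_continuous => p.
apply: (@continuous_comp _ _ _ set_val (@untwist R)).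
  exact: continuous_set_val.
apply: (@continuous_rotate (fun t => - (pi *+ 2 * t))) => t.
by apply: continuousN; exact: mulrl_continuous.
Qed.

Lemma hausdorff_rotation_space : hausdorff_space space.
Proof.
apply: set_type_hausdorff; exact: (@norm_hausdorff R (R * (R * R))%type).
Qed.

Lemma compact_rotation_space : compact [set: space].
Proof.
apply: set_type_compact.
have cK : compact ((`[0, 3] `*` (`[-1, 1] `*` `[-1, 1])) : set (R * (R * R))).
  by apply: compact_setX; [|apply: compact_setX]; exact: segment_compact.
apply: (subclosed_compact _ cK).
  have -> : circle_bundle b = fst @^-1` (@levels R b) `&`
      (fun p : R * (R * R) => p.2.1 ^+ 2 + p.2.2 ^+ 2) @^-1` [set 1] by [].
  apply: closedI; apply: preimage_closed => //.
  - by move=> p _; exact: cvg_fst.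
  - exact: closed_levels.
  - move=> p _; apply: cvgD; apply: cvgM => //;
    by apply: cvg_comp; [exact: cvg_snd|first [exact: cvg_fst|exact: cvg_snd]].
move=> [t [u v]] [/= /levels_itv/andP[t1 t2] uv] /=.
by rewrite !in_itv/=; split; [|split]; nra.
Qed.

Lemma dynamical_system_rotation : dynamical_system (@rotation R b).
Proof.
split; [exact: compact_rotation_space|exact: hausdorff_rotation_space|].
split; first exact: continuous_rotation.
exists (@rotation_inv R b); split; [exact: rotationK|exact: rotation_invK|].
exact: continuous_rotation_inv.
Qed.

Lemma val_iter_rotation k (p : space) : set_val (iter k (@rotation R b) p) =
  ((set_val p).1, plane_rot (pi *+ 2 * (k%:R * (set_val p).1)) (set_val p).2).
Proof.
elim: k => [|k IH]; first by rewrite mul0r mulr0 plane_rot0; case: (set_val p).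
rewrite iterS; transitivity (twist (set_val (iter k (@rotation R b) p))) => //.
by rewrite IH /twist /= -plane_rotD -mulrDr -nat1r [(1 + k%:R) * _]mulrDl mul1r.
Qed.

Lemma circle_bundle_min n (p : R * (R * R)) : circle_bundle b p ->
  circle_bundle b (Num.min p.1 (level b n), p.2).
Proof. by move=> [lp cp]; split => //=; exact: levels_min. Qed.

(** Sends every level above [level n], the limit circle included, onto [level n] with the same
    circle coordinate, and fixes the lower levels. *)
Definition retraction n (p : space) : space :=
  exist (fun p => p \in circle_bundle b) _
    (mem_set (circle_bundle_min n (set_valP p))).

Lemma continuous_retraction n : continuous (retraction n).
Proof.
apply: set_type_continuous => p.
have cmin : continuous (fun p : R * (R * R) => Num.min p.1 (level b n)).
  by move=> q; apply: continuous_min; [exact: cvg_fst|exact: cvg_cst].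
apply: (@continuous_comp _ _ _ set_val
  (fun p : R * (R * R) => (Num.min p.1 (level b n), p.2))).
  exact: continuous_set_val.
exact: (cvg_pair (cmin _) cvg_snd).
Qed.

Lemma iter_rotation_retraction n p :
  iter (level_index b n)`! (@rotation R b) (retraction n p) = retraction n p.
Proof.
apply: val_inj; apply: (etrans (val_iter_rotation _ _)) => /=.
(* After capping, only the finitely many levels up to [n] remain, and they share the period
   [(level_index b n)!]. *)
have [m mn ->] : exists2 m, (m <= n)%N & Num.min (set_val p).1 (level b n) = level b m.
  apply: levels_eq_level; last by rewrite ge_min lexx orbT.
  by apply: levels_min; case: (set_valP p).
by rewrite plane_rot_2pi_int// level_period_int.
Qed.

(** With [N] the level index, the parameter moves by at most [e - level n], so fewer than [N!] steps
    change the angle by at most [2 pi / N]; [plane_rot_dist] doubles this. *)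
Lemma ball_iter_retraction n k p d :
  (k < (level_index b n)`!)%N -> 4 * pi * (level_index b n)%:R^-1 < d ->
  ball (iter k (@rotation R b) (retraction n p)) d (iter k (@rotation R b) p).
Proof.
move=> kq nd.
rewrite -[ball _ _ _]/(ball (set_val _) d (set_val _)) !val_iter_rotation/=.
have [/andP[t0 te] _] := (set_valP p).1.
have cz := (set_valP p).2.
set t := (set_val p).1; set z := (set_val p).2; set N := level_index b n.
have tt : 0 <= t - Num.min t (level b n) <= euler - level b n.
  by case: (leP t (level b n)) => h; apply/andP; split; have := @level_lt_euler R b n; lra.
have q1 : 1 <= N`!%:R :> R by rewrite ler1n fact_gt0.
have kqr : k%:R <= N`!%:R :> R by rewrite ler_nat ltnW.
have rig := @level_rigid R b n; rewrite -/N in rig.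
have p2 := @pi_ge2 R.
move: tt; set s := Num.min t _ => /andP[ts0 ts1].
have ball_R (x y : R) : `|x - y| < d -> ball x d y by [].
have tsq : t - s <= N%:R^-1.
  by rewrite (le_trans ts1)// (le_trans _ rig)// ler_peMl// (le_trans ts0).
have ksq : 2 * `|pi *+ 2 * (k%:R * s) - pi *+ 2 * (k%:R * t)| <= 4 * pi * N%:R^-1.
  have pi0 : 0 <= pi *+ 2 :> R by rewrite mulrn_wge0// pi_ge0.
  rewrite distrC -!mulrBr !normrM (ger0_norm pi0).
  rewrite [`|k%:R|]ger0_norm// [`|t - s|]ger0_norm// mulr2n.
  rewrite (_ : 2 * _ = 4 * pi * (k%:R * (t - s))); last ring.
  have pi4 : 0 < 4 * pi :> R by rewrite mulr_gt0// pi_gt0.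
  rewrite ler_pM2l//.
  by rewrite (le_trans _ rig)// ler_pM.
have [r1 r2] := plane_rot_dist (pi *+ 2 * (k%:R * s)) (pi *+ 2 * (k%:R * t)) cz.
have p1 : 1 <= 4 * pi :> R by have := p2; move: (pi : R) => x; lra.
have tsd : t - s < d.
  by rewrite (le_lt_trans tsq)// (le_lt_trans _ nd)// ler_peMl// invr_ge0.
split; first by apply: ball_R; rewrite /= distrC ger0_norm.
split; apply: ball_R.
  by apply: le_lt_trans nd; exact: le_trans r1 ksq.
by apply: le_lt_trans nd; exact: le_trans r2 ksq.
Qed.

Lemma dense_periodic_measures_rotation : dense_periodic_measures R (@rotation R b).
Proof.
apply: rigid_dense_periodic_measures.
- exact: compact_rotation_space.
- exact: hausdorff_rotation_space.
- exact: continuous_rotation.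
move=> m fs eps cfs eps0.
have : \forall d \near 0^'+, forall i (x y : space), ball x d y ->
    `|fs i x - fs i y| < eps.
  apply: filter_forall => i.
  exact: (uniform_continuity compact_rotation_space (cfs i) eps0).
move=> /(filterI (nbhs_right_gt 0)) /filter_ex[d [/= d0 dP]].
have [n nd] : exists n, 4 * pi * (level_index b n)%:R^-1 < d.
  (* [level_index b n] is at least [n.+1], which exceeds [4 pi / d]. *)
  exists (Num.truncn (4 * pi / d)); set n := Num.truncn _.
  rewrite ltr_pdivrMr ?ltr0n// [d * _]mulrC -ltr_pdivrMr//.
  rewrite (lt_le_trans (truncnS_gt _))// ler_nat /level_index -/n; lia.
exists (level_index b n)`!, (retraction n); split.
- exact: fact_gt0.
- exact: continuous_retraction.
- exact: iter_rotation_retraction.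
- by move=> i k x kq; apply/ltW/dP; exact: ball_iter_retraction.
Qed.

End rotation_dynamics.

(** * Finitely supported invariant measures live on periodic points *)

Section finitely_supported_measures.
Context {R : realType} {X : ptopologicalType} (T : X -> X).
Hypothesis hX : hausdorff_space X.
Variable nu : probability (borel X) R.

Lemma finite_measurable (A : set X) : finite_set A -> @measurable _ (borel X) A.
Proof. exact: hausdorff_finite_measurable. Qed.

(** Points outside [F] are null, so all atoms lie in [F], and the rest of [F] is a finite union of
    null points. Unlike [F], the set of atoms is determined by [nu], hence preserved by [T]. *)
Lemma finitely_supported_atoms : finitely_supported nu ->
  exists A : set X,
    [/\ finite_set A, nu A = 1%E & forall p, A p <-> nu [set p] != 0%E].
Proof.
move=> [F [fF mF nuF]].
have m1 p : @measurable _ (borel X) [set p] by apply: finite_measurable.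
have FC p : ~ F p -> nu [set p] = 0%E.
  move=> Fp; apply: (@subset_measure0 _ _ _ nu [set p] (~` F)) => //.
  - exact: measurableC.
  - by move=> _ ->.
  - by apply: (etrans (probability_setC nu mF)); rewrite nuF subee.
pose A := [set p : X | nu [set p] != 0%E].
have AF : A `<=` F.
  by move=> p /eqP Ap; apply: contrapT => /FC.
have fA : finite_set A := sub_finite_set AF fF.
exists A; split => //.
have fFA : finite_set (F `\` A) by exact: finite_setD.
have FA0 : nu (F `\` A) = 0%E.
  rewrite (_ : F `\` A = \bigcup_(p in F `\` A) [set id p]); last first.
    by rewrite bigcup_imset1 image_id.
  rewrite measure_fin_bigcup//; last first.
    by move=> i j _ _ [x [-> ->]].
  by apply: fsbig1 => p [Fp /negP]; rewrite negbK => /eqP.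
have -> : nu A = nu (F `&` A) by rewrite (setIidr AF).
have : nu F = (nu (F `\` A) + nu (F `&` A))%E.
  exact: (measureDI nu mF (finite_measurable fA)).
by rewrite nuF [nu (F `\` A)]FA0 add0e => <-.
Qed.

(** Injectivity makes [p] the only preimage of [T p], so both have the same mass and atoms go to
    atoms. A nonperiodic atom would have infinitely many distinct iterates in a finite set. *)
Lemma finitely_supported_periodic (S : X -> X) : continuous T -> cancel T S ->
  Defs.invariant T nu -> finitely_supported nu ->
  exists A : set X, [/\ finite_set A, nu A = 1%E, forall p, A p -> A (T p) &
    forall p, A p -> exists2 m, (0 < m)%N & iter m T p = p].
Proof.
move=> cT TS nuT /finitely_supported_atoms[A [fA nuA AE]].
have AT p : A p -> A (T p).
  rewrite !AE -(nuT [set T p]); last exact: finite_measurable.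
  rewrite (_ : T @^-1` [set T p] = [set p])//.
  by apply/seteqP; split=> x /= => [/(can_inj TS)|->].
have itA k p : A p -> A (iter k T p) by elim: k => // k IH /IH /AT.
have it_inj k : injective (iter k T).
  by elim: k => // k IH x y; rewrite !iterS => /(can_inj TS) /IH.
exists A; split => // p Ap; apply: contrapT => np; apply: infinite_nat.
have -> : [set: nat] = (fun k => iter k T p) @^-1` A.
  by apply/seteqP; split=> k // _; exact: itA.
apply: finite_preimage => // i j _ _ ij.
wlog lt_ij : i j ij / (i < j)%N => [W|].
  by case: (ltngtP i j) => // h; [exact: W|exact/esym/W].
exfalso; apply: np; exists (j - i)%N; first by rewrite subn_gt0.
by apply: (it_inj i); rewrite -iterD subnKC// ltnW.
Qed.

(* On the atoms, all periodic, [f] is the coboundary [G - G \o T]. *)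
Lemma finitely_supported_coboundary (S : X -> X) (f G : X -> R) M :
  continuous T -> cancel T S -> Defs.invariant T nu -> finitely_supported nu ->
  continuous f -> (forall x, `|f x| <= M) ->
  (forall p m, (0 < m)%N -> iter m T p = p -> f p = G p - G (T p)) ->
  Rintegral nu [set: borel X] f = 0.
Proof.
move=> cT TS nuT fnu cf fM fG.
have [A [fA nuA AT Aper]] := finitely_supported_periodic cT TS nuT fnu.
have mA := finite_measurable fA.
(* Cutting [G] off outside the finite set [A] makes it measurable and bounded, so that it can be
   integrated. *)
pose g (x : borel X) := if x \in A then G x else 0.
have mg : measurable_fun [set: borel X] g.
  move=> _ Y mY; rewrite setTI.
  have -> : g @^-1` Y = (A `&` G @^-1` Y) `|` (~` A `&` [set _ | Y 0]).
    apply/seteqP; split=> x /=; rewrite /g.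
      by case: ifPn; rewrite ?inE ?notin_setE => Ax Yx; [left|right].
    by move=> [[Ax Yx]|[Ax Y0]]; [rewrite mem_set|rewrite memNset].
  apply: measurableU.
    by apply: finite_measurable; apply: sub_finite_set fA; exact: subIsetl.
  apply: measurableI; first exact: measurableC.
  by case: (pselect (Y 0)) => Y0; [rewrite (_ : [set _ | _] = setT)|
    rewrite (_ : [set _ | _] = set0)] => //; apply/seteqP; split=> x.
have [K gK] : exists K, forall x, `|g x| <= K.
  have /compact_bounded[K [_ GK]] : compact ((G : X -> R) @` A).
    exact/finite_compact/finite_image.
  exists (`|K| + 1) => x; rewrite /g; case: ifPn => [|_]; last first.
    by rewrite normr0 addr_ge0.
  by rewrite inE => Ax; apply: GK; [rewrite (le_lt_trans (ler_norm _))// ltrDl|exists x].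
have mT := borel_continuous_measurable cT.
have mgT : measurable_fun [set: borel X] (g \o T).
  exact: (measurableT_comp mg mT).
(* The integrands agree on [A], which has full measure: its points are periodic and [T] keeps them
   in [A]. *)
have fgE : Rintegral nu [set: borel X] f =
    Rintegral nu [set: borel X] (fun x => g x - g (T x)).
  rewrite /Rintegral; congr fine; apply: ae_eq_integral => //.
  - by apply/measurable_EFinP; exact: (borel_continuous_measurableR cf).
  - by apply/measurable_EFinP; exact: measurable_funB.
  exists (~` A); split; first exact: measurableC.
    by apply: (etrans (probability_setC nu mA)); rewrite nuA subee.
  apply: subsetC => x Ax _ /=; have [m m0 Tm] := Aper x Ax.
  by rewrite /g !mem_set//; [rewrite (fG _ _ m0 Tm)|exact: AT].
rewrite fgE RintegralB//.
- rewrite -(invariant_Rintegral cT nuT mg gK) subrr//.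
- exact: bounded_probability_integrable gK.
- exact: (bounded_probability_integrable nu mgT (fun x => gK _)).
Qed.

End finitely_supported_measures.

(** * Lebesgue measure on the circle of length one *)

Section periodic_lebesgue.
Context {R : realType}.
Local Notation leb := (@lebesgue_measure R).

Lemma lebesgue_measure_translation (c : R) (A : set R) : measurable A ->
  leb [set x | A (x + c)] = leb A.
Proof.
move=> mA; apply/esym.
have mc : measurable_fun [set: measurableTypeR R]
    ((fun x => x + c) : measurableTypeR R -> measurableTypeR R).
  by apply: measurable_funD.
pose Tm : {mfun measurableTypeR R >-> measurableTypeR R} :=
  HB.pack ((fun x => x + c) : measurableTypeR R -> measurableTypeR R)
    (isMeasurableFun.Build _ _ _ _ _ mc).
apply: (@lebesgue_measure_unique R (pushforward leb Tm)) => // _ [[a b] _ <-] /=.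
rewrite /pushforward (_ : _ @^-1` _ = `]a - c, b - c]%classic); last first.
  by apply/seteqP; split=> x /=; rewrite !in_itv/= ltrBlDr lerBrDr.
rewrite !lebesgue_measure_itv/= !lte_fin ltrD2r.
by case: ifPn => // _; rewrite !EFinD -!EFinD; congr EFin; ring.
Qed.

(** Translation moves the window to [[c, 1 + c[]; its part beyond 1 is carried back to [[0, c[] by
    periodicity. *)
Lemma lebesgue_measure_periodic (E : set R) (c : R) : measurable E ->
  (forall x, E (x + 1) <-> E x) -> 0 <= c < 1 ->
  leb ([set x | E (x + c)] `&` `[0, 1[%classic) = leb (E `&` `[0, 1[%classic).
Proof.
move=> mE E1 /andP[c0 c1].
have mEI (i : interval R) : measurable (E `&` [set` i]) by exact: measurableI.
have split3 (x y z : R) : x <= y -> y <= z ->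
    leb (E `&` `[x, z[%classic) =
    (leb (E `&` `[x, y[%classic) + leb (E `&` `[y, z[%classic))%E.
  move=> xy yz; rewrite (_ : E `&` `[x, z[%classic =
      (E `&` `[x, y[%classic) `|` (E `&` `[y, z[%classic)).
    apply: measureU; [exact: mEI|exact: mEI|].
    apply/seteqP; split=> // t [[_ /=]].
    rewrite in_itv/= => /andP[_ ty] [_ /=].
    by rewrite in_itv/= leNgt ty.
  apply/seteqP; split=> t /=; rewrite !in_itv/=.
    by move=> [Et /andP[xt tz]]; case: (ltP t y) => ty; [left|right];
      split=> //; apply/andP.
  move=> [|] [Et /andP[xt tz]]; split=> //; apply/andP; split=> //.
    exact: lt_le_trans yz.
  exact: le_trans xt.
transitivity (leb (E `&` `[c, 1 + c[%classic)).
  rewrite -(lebesgue_measure_translation c (mEI _)); congr (leb _).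
  by apply/seteqP; split=> x /=; rewrite !in_itv/= lerDr ltrD2r.
rewrite (split3 c 1) ?lerDl//; last exact: ltW.
rewrite [RHS](split3 0 c 1)//; last exact: ltW.
rewrite addeC; congr (_ + _)%E.
rewrite -(lebesgue_measure_translation 1 (mEI _)); congr (leb _).
by apply/seteqP; split=> x /=; rewrite !in_itv/= lerDr [1 + c]addrC ltrD2r;
  move=> [/E1 Ex xc].
Qed.

Lemma uniform_unit_interval : exists P : probability (measurableTypeR R) R,
  forall A, P A = leb (A `&` `[0, 1[%classic).
Proof.
have mI : measurable (`[0, 1[%classic : set (measurableTypeR R)) by [].
have P1 : mrestr leb mI setT = 1%E.
  by rewrite /mrestr setTI lebesgue_measure_itv/= lte_fin ltr01 oppr0 adde0.
pose mx := Measure_isProbability.Build _ _ _ (mrestr leb mI) P1.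
by exists (HB.pack (mrestr leb mI) mx : probability (measurableTypeR R) R).
Qed.

End periodic_lebesgue.
(* Naming the product as a function of two abstract spaces keeps unification
   from unfolding the concrete factors. *)
Definition ptop_prod (R : realType) (X Y : pseudoPMetricType R)
  : ptopologicalType := (X * Y)%type.

(** * Topology of products *)

Section ptop_prod.
Context {R : realType} {X Y : pseudoPMetricType R}.

Lemma hausdorff_prod : hausdorff_space X -> hausdorff_space Y ->
  hausdorff_space (ptop_prod X Y).
Proof.
move=> hX hY [x1 y1] [x2 y2] cl; congr (_, _).
- apply: hX => A B nA nB.
  have [||z [Az Bz]] := cl (fst @^-1` A) (fst @^-1` B); last by exists z.1.
  + exact: (@cvg_fst _ _ (nbhs x1) (nbhs y1) _ A nA).
  + exact: (@cvg_fst _ _ (nbhs x2) (nbhs y2) _ B nB).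
- apply: hY => A B nA nB.
  have [||z [Az Bz]] := cl (snd @^-1` A) (snd @^-1` B); last by exists z.2.
  + exact: (@cvg_snd _ _ (nbhs x1) (nbhs y1) _ A nA).
  + exact: (@cvg_snd _ _ (nbhs x2) (nbhs y2) _ B nB).
Qed.

Lemma compact_prod : compact [set: X] -> compact [set: Y] ->
  compact [set: ptop_prod X Y].
Proof. by move=> cX cY; have := compact_setX cX cY; rewrite setXTT. Qed.

Lemma continuous_comp_fst (Z : topologicalType) (f : X -> Z) :
  continuous f -> continuous (fun p : ptop_prod X Y => f p.1).
Proof.
by move=> cf p; apply: (@continuous_comp _ _ _ fst f); [exact: cvg_fst|exact: cf].
Qed.

Lemma continuous_comp_snd (Z : topologicalType) (f : Y -> Z) :
  continuous f -> continuous (fun p : ptop_prod X Y => f p.2).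
Proof.
by move=> cf p; apply: (@continuous_comp _ _ _ snd f); [exact: cvg_snd|exact: cf].
Qed.

Lemma continuous_pair (Z : topologicalType) (f : Z -> X) (g : Z -> Y) :
  continuous f -> continuous g ->
  continuous (fun z => (f z, g z) : ptop_prod X Y).
Proof. by move=> cf cg z; exact: (cvg_pair (cf z) (cg z)). Qed.

Lemma continuous_prod_map (f : X -> X) (g : Y -> Y) :
  continuous f -> continuous g ->
  continuous (prod_map f g : ptop_prod X Y -> ptop_prod X Y).
Proof.
move=> cf cg; apply: continuous_pair.
  exact: continuous_comp_fst.
exact: continuous_comp_snd.
Qed.

(** This is the shape of [inner], treated with abstract factors. *)
Lemma continuous_sum_mul (f1 f2 : X -> R) (g1 g2 : Y -> R) :
  continuous f1 -> continuous f2 -> continuous g1 -> continuous g2 ->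
  continuous (fun p : ptop_prod X Y => f1 p.1 * g1 p.2 + f2 p.1 * g2 p.2).
Proof.
move=> /continuous_comp_fst cf1 /continuous_comp_fst cf2.
move=> /continuous_comp_snd cg1 /continuous_comp_snd cg2 p.
exact: (cvgD (cvgM (cf1 p) (cg1 p)) (cvgM (cf2 p) (cg2 p))).
Qed.

End ptop_prod.

(** * The product system and its obstruction *)

Section product_rotation_dynamics.
Context {R : realType}.
Definition even_space : pseudoPMetricType R := @rotation_space R false.
Definition odd_space : pseudoPMetricType R := @rotation_space R true.
Definition product_space : ptopologicalType := ptop_prod even_space odd_space.
Definition product_rotation : product_space -> product_space :=
  prod_map (@rotation R false) (@rotation R true).

(** The real part of [z1 * conj z2]; [outer] is the imaginary part. *)
Definition inner (p : product_space) : R :=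
  (set_val p.1).2.1 * (set_val p.2).2.1 + (set_val p.1).2.2 * (set_val p.2).2.2.

Definition outer (p : product_space) : R :=
  (set_val p.1).2.2 * (set_val p.2).2.1 - (set_val p.1).2.1 * (set_val p.2).2.2.

Definition angle (p : product_space) : R :=
  pi *+ 2 * (set_val p.1).1 - pi *+ 2 * (set_val p.2).1.

(* With [w = exp (i angle)] and [h = inner + i outer], the map multiplies [h]
   by [w], and this is the real part of [h / (1 - w)] when [w <> 1]. *)
Definition primitive (p : product_space) : R :=
  inner p / 2 - outer p * sin (angle p) / (2 * (1 - cos (angle p))).

Lemma inner_product_rotation p :
  inner (product_rotation p) = cos (angle p) * inner p - sin (angle p) * outer p.
Proof. by rewrite /inner /outer /angle /= cosB sinB; ring. Qed.

Lemma outer_product_rotation p :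
  outer (product_rotation p) = sin (angle p) * inner p + cos (angle p) * outer p.
Proof. by rewrite /inner /outer /angle /= cosB sinB; ring. Qed.

Lemma inner_coboundary p : cos (angle p) != 1 ->
  inner p = primitive p - primitive (product_rotation p).
Proof.
move=> c1; rewrite /primitive inner_product_rotation outer_product_rotation.
rewrite (_ : angle (product_rotation p) = angle p)//.
have := cos2Dsin2 (angle p).
move: (cos _) (sin _) (inner p) (outer p) c1 => c s u v c1 cs.
have c1' : 1 - c != 0 by rewrite subr_eq0 eq_sym.
have s2 : s ^+ 2 = (1 - c) * (1 + c) by rewrite -subr_sqr expr1n -cs; ring.
(* The terms in [outer] cancel, and [s ^+ 2 / (1 - c) = 1 + c] supplies the remaining part of
   [u]. *)
transitivity ((1 - c) * u / 2 + s ^+ 2 * (u / (2 * (1 - c)))).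
  by rewrite s2; field.
by field.
Qed.

Lemma iter_product_rotation m (p : product_space) :
  iter m product_rotation p = (iter m (@rotation R false) p.1, iter m (@rotation R true) p.2).
Proof. by elim: m => [|m IH]; [case: p|rewrite iterS IH]. Qed.

(** If the cosine is 1, the parameters differ by an integer; lying in [[5/2, 3[] they coincide,
    hence equal e. Periodicity of the first coordinate would then make [m e] an integer. *)
Lemma periodic_angle m p : (0 < m)%N -> iter m product_rotation p = p -> cos (angle p) != 1.
Proof.
move=> m0; rewrite iter_product_rotation => /(congr1 fst)/= pm; apply/eqP => c1.
have l0 := (set_valP p.1).1; have l1 := (set_valP p.2).1.
have z0 := (set_valP p.1).2.
have int_diff : (set_val p.1).1 - (set_val p.2).1 \is a Num.int.
  by apply: cos_2pi_eq1; rewrite mulrBr.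
have t01 : (set_val p.1).1 = (set_val p.2).1.
  have /andP[a1 a2] := levels_itv l0; have /andP[b1 b2] := levels_itv l1.
  move/intrP: int_diff => [n nE].
  have n1 : (n%:~R : R) < 1 by rewrite -nE; move: a1 a2 b1 b2; lra.
  have n2 : (-1 : R) < n%:~R by rewrite -nE; move: a1 a2 b1 b2; lra.
  have n0 : n = 0.
    move: n1 n2; rewrite ltrz1 -[(-1 : R)]/((-1)%:~R) ltr_int; lia.
  by apply/subr0_eq; rewrite nE n0.
have te : (set_val p.1).1 = euler.
  by apply: levels_cap => //; rewrite t01.
have : m%:R * (euler : R) \isn't a Num.int by exact: euler_irrational.
apply/negP; rewrite negbK; apply: cos_2pi_eq1.
have := congr1 set_val pm; rewrite val_iter_rotation te => /(congr1 snd)/=.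
move: z0; case: (set_val p.1).2 => u v /= uv; set x := _ * _.
rewrite /plane_rot /= => -[e1 e2].
(* The cosine is the scalar product of the unit vector [(u, v)] with its rotated image, here the
   vector itself. *)
rewrite -[LHS]mulr1 -uv.
rewrite (_ : cos x * _ = (cos x * u - sin x * v) * u + (sin x * u + cos x * v) * v).
  by rewrite e1 e2 uv.
ring.
Qed.

Lemma compact_product : compact [set: product_space].
Proof.
have c0 : compact [set: even_space] by exact: compact_rotation_space.
have c1 : compact [set: odd_space] by exact: compact_rotation_space.
exact: (compact_prod c0 c1).
Qed.

Lemma hausdorff_product : hausdorff_space product_space.
Proof.
have h0 : hausdorff_space even_space by exact: hausdorff_rotation_space.
have h1 : hausdorff_space odd_space by exact: hausdorff_rotation_space.
exact: (hausdorff_prod h0 h1).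
Qed.

Lemma continuous_product_rotation : continuous product_rotation.
Proof.
have c0 : continuous (@rotation R false : even_space -> even_space).
  exact: continuous_rotation.
have c1 : continuous (@rotation R true : odd_space -> odd_space).
  exact: continuous_rotation.
exact: (continuous_prod_map c0 c1).
Qed.

Lemma continuous_fiber1 b : continuous (fun p : @rotation_space R b => (set_val p).2.1).
Proof.
have c1 : continuous (fun q : R * (R * R) => q.2.1).
  by move=> q; exact: (@continuous_comp _ _ _ snd fst q cvg_snd cvg_fst).
by move=> p; exact: (continuous_comp (@continuous_set_val _ _ p) (c1 _)).
Qed.

Lemma continuous_fiber2 b : continuous (fun p : @rotation_space R b => (set_val p).2.2).
Proof.
have c1 : continuous (fun q : R * (R * R) => q.2.2).
  by move=> q; exact: (@continuous_comp _ _ _ snd snd q cvg_snd cvg_snd).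
by move=> p; exact: (continuous_comp (@continuous_set_val _ _ p) (c1 _)).
Qed.

Lemma continuous_inner : continuous (inner : product_space -> R).
Proof.
have u0 : continuous (fun p : even_space => (set_val p).2.1).
  exact: continuous_fiber1.
have u1 : continuous (fun p : odd_space => (set_val p).2.1).
  exact: continuous_fiber1.
have v0 : continuous (fun p : even_space => (set_val p).2.2).
  exact: continuous_fiber2.
have v1 : continuous (fun p : odd_space => (set_val p).2.2).
  exact: continuous_fiber2.
exact: (continuous_sum_mul u0 v0 u1 v1).
Qed.

Lemma finitely_supported_inner (nu : probability (borel product_space) R) :
  Defs.invariant product_rotation nu -> finitely_supported nu ->
  Rintegral nu [set: borel product_space] (inner : borel product_space -> R) = 0.
Proof.
move=> nuT fnu.
have [M _ innerM] := compact_continuous_bounded compact_product continuous_inner.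
pose S := prod_map (@rotation_inv R false) (@rotation_inv R true).
apply: (@finitely_supported_coboundary _ _ product_rotation _ nu S _ primitive M) => //.
- exact: hausdorff_product.
- exact: continuous_product_rotation.
- by case=> p q; rewrite /S /prod_map /= !rotationK.
- exact: continuous_inner.
- by move=> p m m0 Tm; apply/inner_coboundary/(periodic_angle m0).
Qed.

(** [x] counts turns, so that the parametrisation has period 1. *)
Definition diagonal_point (x : R) : product_space :=
  (euler_point false (pi *+ 2 * x), euler_point true (pi *+ 2 * x)).

Lemma inner_diagonal_point x : inner (diagonal_point x) = 1.
Proof. by rewrite /inner /= -!expr2 cos2Dsin2. Qed.

Lemma continuous_diagonal_point : continuous diagonal_point.
Proof.
have ce b : continuous (fun x : R => euler_point b (pi *+ 2 * x)).
  apply: set_type_continuous => x /=.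
  have cc : {for x, continuous (fun x => cos (pi *+ 2 * x))}.
    by apply: continuous_comp; [exact: mulrl_continuous|exact: continuous_cos].
  have cs : {for x, continuous (fun x => sin (pi *+ 2 * x))}.
    by apply: continuous_comp; [exact: mulrl_continuous|exact: continuous_sin].
  exact: (cvg_pair (cvg_cst _) (cvg_pair cc cs)).
have c0 : continuous (fun x : R => euler_point false (pi *+ 2 * x) : even_space).
  exact: ce.
have c1 : continuous (fun x : R => euler_point true (pi *+ 2 * x) : odd_space).
  exact: ce.
exact: (continuous_pair c0 c1).
Qed.

Lemma measurable_diagonal_point :
  measurable_fun [set: measurableTypeR R] (diagonal_point : _ -> borel product_space).
Proof.
apply: (@measurability _ _ (measurableTypeR R) (borel product_space) setT _ (@open product_space) erefl).
move=> _ [A oA <-]; rewrite setTI; apply: open_measurable.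
by have /continuousP := continuous_diagonal_point; exact.
Qed.

Lemma plane_rot_circle (x y : R) :
  plane_rot (pi *+ 2 * x) (cos (pi *+ 2 * y), sin (pi *+ 2 * y)) =
  (cos (pi *+ 2 * (y + x)), sin (pi *+ 2 * (y + x))).
Proof.
rewrite /plane_rot /= addrC mulrDr cosD sinD; congr (_, _); ring.
Qed.

(** Two full turns are dropped because [e - 2] lies in [[0, 1[], the range of shifts in
    [lebesgue_measure_periodic]. *)
Lemma product_rotation_diagonal_point x :
  product_rotation (diagonal_point x) = diagonal_point (x + (euler - 2)).
Proof.
have two : (2 : R) \is a Num.int by rewrite rpred_nat.
have step : plane_rot (pi *+ 2 * euler) (cos (pi *+ 2 * x), sin (pi *+ 2 * x)) =
    (cos (pi *+ 2 * (x + (euler - 2))), sin (pi *+ 2 * (x + (euler - 2)))) :> R * R.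
  rewrite plane_rot_circle (_ : x + euler = x + (euler - 2) + 2); last ring.
  by rewrite -plane_rot_circle plane_rot_2pi_int.
by rewrite /prod_map /diagonal_point /=; congr (_, _); apply: val_inj;
  rewrite /= /twist /= step.
Qed.

Lemma diagonal_pointD1 x : diagonal_point (x + 1) = diagonal_point x.
Proof.
have one : (1 : R) \is a Num.int by rewrite rpred1.
rewrite /diagonal_point; congr (_, _); apply: val_inj => /=;
  by rewrite -plane_rot_circle plane_rot_2pi_int.
Qed.

(** The image of the uniform measure on [[0, 1[] under [diagonal_point]: the rotation acts on it as
    a translation modulo 1, and [inner] is constantly 1 there. *)
Lemma diagonal_measure : exists mu : probability (borel product_space) R,
  Defs.invariant product_rotation mu /\
  Rintegral mu [set: borel product_space] (inner : borel product_space -> R) = 1.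
Proof.
have [P PE] := @uniform_unit_interval R.
pose D : {mfun measurableTypeR R >-> borel product_space} :=
  HB.pack (diagonal_point : measurableTypeR R -> borel product_space)
    (isMeasurableFun.Build _ _ _ _ _ measurable_diagonal_point).
have [M _ innerM] := compact_continuous_bounded compact_product continuous_inner.
exists (distribution P D); split.
- move=> A mA; apply: (etrans (PE _)); apply: (etrans _ (esym (PE _))).
  rewrite -(@lebesgue_measure_periodic R (diagonal_point @^-1` A) (euler - 2)).
  + congr (lebesgue_measure (_ `&` _)).
    by apply/seteqP; split=> x /=; rewrite product_rotation_diagonal_point.
  + by rewrite -[X in measurable X]setTI; exact: measurable_diagonal_point.
  + by move=> x /=; rewrite diagonal_pointD1.
  + have /andP[? ?] := levels_itv (@levels_euler R false).
    by apply/andP; split; lra.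
- have mi := borel_continuous_measurableR continuous_inner.
  rewrite (Rintegral_distribution P D mi innerM).
  rewrite -[RHS](Rintegral_probability_cst P 1).
  by apply: eq_Rintegral => x _ /=; rewrite inner_diagonal_point.
Qed.

Lemma not_dense_periodic_measures_product :
  ~ @dense_periodic_measures R product_space product_rotation.
Proof.
have [mu [muT mu1]] := diagonal_measure.
(* The single test function [inner] with radius 1 suffices: the two integrals are 1 and 0. *)
move=> /(_ mu muT 1%N (fun=> inner) 1 (fun=> continuous_inner) ltr01)[nu [nuT fnu]].
move=> /(_ ord0); rewrite mu1 finitely_supported_inner// subr0 normr1.
by rewrite ltxx.
Qed.

End product_rotation_dynamics.

Theorem theorem1p3 (R : realType) :
  exists (X1 : pseudoPMetricType R) (T1 : X1 -> X1)
         (X2 : pseudoPMetricType R) (T2 : X2 -> X2),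
    [/\ dynamical_system T1, dynamical_system T2,
        dense_periodic_measures R T1, dense_periodic_measures R T2 &
        ~ @dense_periodic_measures R (X1 * X2)%type (prod_map T1 T2)].
Proof.
exists (@rotation_space R false), (@rotation R false).
exists (@rotation_space R true), (@rotation R true).
split; [exact: dynamical_system_rotation|exact: dynamical_system_rotation| | |].
- exact: dense_periodic_measures_rotation.
- exact: dense_periodic_measures_rotation.
- exact: not_dense_periodic_measures_product.
Qed.
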